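(* Let $R$ be any ring. (i) If there is a family of propositional tautologies for which Hilbert-like $\mathrm{IPS}_R$ proofs require super-polynomial size, then $\mathsf{VNP}_R\neq\mathsf{VP}_R$; likewise, a super-polynomial lower bound on constant-free Hilbert-like $\mathrm{IPS}_R$ proofs of some family of tautologies implies $\mathsf{VNP}^0_R\neq\mathsf{VP}^0_R$. (ii) If there is a family of propositional tautologies for which Polynomial Calculus proofs require a super-polynomial number of lines, then the Permanent versus Determinant Conjecture holds, i.e. $\mathsf{VNP}\neq\mathsf{VP}_{ws}$.
   Context: IPS (Ideal Proof System): for polynomials $F_1,\dots,F_m\in R[x_1,\dots,x_n]$, an IPS certificate of unsatisfiability of $F_1=\dots=F_m=0$ is a polynomial $C(\vec x,\vec y)\in R[x_1,\dots,x_n,y_1,\dots,y_m]$ ($y_i$ new ''placeholder'' variables) with $C(\vec x,\vec 0)=0$ and $C(\vec x,F_1(\vec x),\dots,F_m(\vec x))=1$. It is Hilbert-like if it has the form $\sum_i y_iG_i(\vec x)$. An $\mathrm{IPS}_R$ proof is an algebraic circuit over $R$ with inputs $\vec x,\vec y$ computing an IPS certificate; its size is its circuit size (families of proofs are by default required to have polynomial degree). A constant-free circuit uses only the constants $0,1,-1$. A tautology is handled through the unsatisfiable CNF $\kappa_1\wedge\dots\wedge\kappa_m$ it corresponds to: each clause $\kappa$ is translated into the polynomial obtained as the product over its literals of $1-x$ for a positive literal $x$ and $x$ for a negative literal $\neg x$ (so a $0/1$ assignment satisfies $\kappa$ iff the polynomial vanishes), and the system also contains $x_i^2-x_i$ for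 every variable; an IPS proof of the tautology is an IPS proof of unsatisfiability of this system. $\mathsf{VP}_R$: families $(f_n)$ of polynomials with $\mathrm{poly}(n)$ variables and degree computable by $\mathrm{poly}(n)$-size algebraic circuits over $R$. $\mathsf{VNP}_R$: families $g_n(\vec x)=\sum_{\vec e\in\{0,1\}^{\mathrm{poly}(n)}}f_n(\vec e,\vec x)$ with $(f_n)\in\mathsf{VP}_R$ and $g_n$ of polynomial degree and number of variables. $\mathsf{VP}^0_R,\mathsf{VNP}^0_R$ are the same with constant-free circuits. A circuit of fan-in at most 2 is weakly skew if for every multiplication gate, one of its two input subcircuits is connected to the rest of the circuit only through that gate; $\mathsf{VP}_{ws}$ is the class of families computed by polynomial-size weakly skew circuits (equivalently, p-projections of the determinant). Polynomial Calculus (number-of-lines measure): a derivation of $1$ from $F_1,\dots,F_m$ where each line is one of the $F_i$, or $\alpha G+\beta H$ for earlier lines $G,H$ and field elements $\alpha,\beta$, or $x_iG$ for an earlier line $G$ and a variable $x_i$; its size is its number of lines. *)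

(* Defs.v *)
From HB Require Import structures.
From mathcomp Require Import all_boot all_order all_algebra.
From mathcomp Require Import mpoly.
Set Implicit Arguments. Unset Strict Implicit. Unset Printing Implicit Defensive.
Import Order.TTheory GRing.Theory.
Local Open Scope ring_scope.

Definition polyb (f : nat -> nat) : Prop :=
  exists c : nat, forall n : nat, (f n <= c * n ^ c + c)%N.

(* Algebraic circuits of fan-in at most 2, as straight-line programs.   *)
(* Gate number p may only refer to gates j < p; the output is the last  *)
(* gate; the size is the number of gates.  Input gate [GIn i] is the     *)
(* i-th input variable (numbered from 0).                                *)
Inductive gate (R : Type) :=
| GIn of nat
| GConst of R
| GAdd of nat & nat
| GMul of nat & nat.
Arguments GIn {R}.
Arguments GAdd {R}.
Arguments GMul {R}.

Definition circuit (R : Type) := seq (gate R).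

Definition grefs (R : Type) (g : gate R) : seq nat :=
  match g with GAdd j k | GMul j k => [:: j; k] | _ => [::] end.

Definition gat (R : Type) (C : circuit R) (p : nat) : gate R := nth (GIn 0) C p.

Definition wf_circuit (R : Type) (nin : nat) (C : circuit R) : Prop :=
  C <> [::] /\
  forall p, (p < size C)%N ->
    (forall j, j \in grefs (gat C p) -> (j < p)%N) /\
    (forall i, gat C p = GIn i -> (i < nin)%N).

Definition constant_free (R : nzRingType) (C : circuit R) : Prop :=
  forall (p : nat) (c : R), (p < size C)%N -> gat C p = GConst c ->
    c = 0 \/ c = 1 \/ c = -1.

Definition circ_ok (R : nzRingType) (cf : bool) (C : circuit R) : Prop :=
  if cf then constant_free C else True.

Definition eval_gate (R : nzRingType) (k : nat) (env : nat -> {mpoly R[k]})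
    (vals : seq {mpoly R[k]}) (g : gate R) : {mpoly R[k]} :=
  match g with
  | GIn i => env i
  | GConst c => c%:MP
  | GAdd j l => nth 0 vals j + nth 0 vals l
  | GMul j l => nth 0 vals j * nth 0 vals l
  end.

Definition eval_vals (R : nzRingType) (k : nat) (env : nat -> {mpoly R[k]})
    (C : circuit R) : seq {mpoly R[k]} :=
  foldl (fun vals g => rcons vals (eval_gate env vals g)) [::] C.

Definition eval_circ (R : nzRingType) (k : nat) (env : nat -> {mpoly R[k]})
    (C : circuit R) : {mpoly R[k]} := last 0 (eval_vals env C).

(* input i is sent to the variable 'X_i (inputs out of range are not used
   by well-formed circuits) *)
Definition var_env (R : nzRingType) (k : nat) (i : nat) : {mpoly R[k]} :=
  oapp (fun o : 'I_k => 'X_o) 0 (insub i).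

Definition cpoly (R : nzRingType) (k : nat) (C : circuit R) : {mpoly R[k]} :=
  eval_circ (@var_env R k) C.

Definition computes (R : nzRingType) (k : nat) (C : circuit R) (f : {mpoly R[k]}) :=
  wf_circuit k C /\ cpoly k C = f.

Inductive reach (R : Type) (C : circuit R) : nat -> nat -> Prop :=
| reach_refl j : reach C j j
| reach_step j r q : r \in grefs (gat C j) -> reach C r q -> reach C j q.

(* the subcircuit of input j of the multiplication gate p (with other
   input l) is connected to the rest of the circuit only through p *)
Definition separated (R : Type) (C : circuit R) (p j l : nat) : Prop :=
  ~ reach C j l /\
  forall q r, (q < size C)%N -> q <> p -> ~ reach C j q ->
    r \in grefs (gat C q) -> ~ reach C j r.

Definition weakly_skew (R : Type) (C : circuit R) : Prop :=
  forall p j l, (p < size C)%N -> gat C p = GMul j l ->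
    separated C p j l \/ separated C p l j.

Definition VPc (R : nzRingType) (cf : bool) (k : nat -> nat)
    (f : forall n, {mpoly R[k n]}) : Prop :=
  polyb k /\ polyb (fun n => msize (f n)) /\
  exists C : nat -> circuit R,
    polyb (fun n => size (C n)) /\
    forall n, circ_ok cf (C n) /\ computes (C n) (f n).

Definition VPws (R : nzRingType) (k : nat -> nat)
    (f : forall n, {mpoly R[k n]}) : Prop :=
  polyb k /\ polyb (fun n => msize (f n)) /\
  exists C : nat -> circuit R,
    polyb (fun n => size (C n)) /\
    forall n, weakly_skew (C n) /\ computes (C n) (f n).

Definition sum_env (R : nzRingType) (m k : nat) (e : {ffun 'I_m -> bool})
    (i : nat) : {mpoly R[k]} :=
  if (i < m)%N then oapp (fun o : 'I_m => (e o)%:R) 0 (insub i)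
  else var_env R k (i - m).

Definition VNPc (R : nzRingType) (cf : bool) (k : nat -> nat)
    (f : forall n, {mpoly R[k n]}) : Prop :=
  polyb k /\ polyb (fun n => msize (f n)) /\
  exists (m : nat -> nat) (C : nat -> circuit R),
    polyb m /\ polyb (fun n => size (C n)) /\
    polyb (fun n => msize (cpoly (m n + k n) (C n))) /\
    forall n, circ_ok cf (C n) /\ wf_circuit (m n + k n) (C n) /\
      f n = \sum_(e : {ffun 'I_(m n) -> bool}) eval_circ (@sum_env R (m n) (k n) e) (C n).

Record cnf := CNF {
  cnf_nv : nat;
  cnf_clauses : seq (seq ('I_cnf_nv * bool))      (* literal (v,true) = v,
                                                     (v,false) = ~ v     *)
}.

Definition cnf_size (phi : cnf) : nat :=
  (cnf_nv phi + size (cnf_clauses phi) + sumn (map size (cnf_clauses phi)))%N.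

Definition cnf_unsat (phi : cnf) : Prop :=
  forall a : 'I_(cnf_nv phi) -> bool,
    exists2 cl, cl \in cnf_clauses phi & forall l, l \in cl -> a l.1 != l.2.

Definition lit_poly (R : nzRingType) (nv : nat) (l : 'I_nv * bool) : {mpoly R[nv]} :=
  if l.2 then 1 - 'X_l.1 else 'X_l.1.

Definition clause_poly (R : nzRingType) (nv : nat) (cl : seq ('I_nv * bool))
  : {mpoly R[nv]} := \prod_(l <- cl) lit_poly R l.

Definition cnf_system (R : nzRingType) (phi : cnf) : seq {mpoly R[cnf_nv phi]} :=
  map (@clause_poly R _) (cnf_clauses phi) ++
  [seq 'X_i ^+ 2 - 'X_i | i <- enum 'I_(cnf_nv phi)].

(* IPS.  Variables x_0..x_(n-1) are inputs 0..n-1, placeholders          *)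
(* y_0..y_(m-1) are inputs n..n+m-1.                                      *)
Definition subst_y (R : nzRingType) (n : nat) (Fs : seq {mpoly R[n]})
    (ys : 'I_(size Fs) -> {mpoly R[n]}) : (n + size Fs).-tuple {mpoly R[n]} :=
  [tuple match split i with inl a => 'X_a | inr b => ys b end
   | i < n + size Fs].

Definition x_embed (R : nzRingType) (n m : nat) (p : {mpoly R[n]}) : {mpoly R[n + m]} :=
  p \mPo [tuple 'X_(lshift m a) | a < n].

Definition IPS_cert (R : nzRingType) (n : nat) (Fs : seq {mpoly R[n]})
    (P : {mpoly R[n + size Fs]}) : Prop :=
  P \mPo @subst_y R n Fs (fun _ => 0) = 0 /\
  P \mPo @subst_y R n Fs (fun b => nth 0 Fs b) = 1.

Definition hilbert_like (R : nzRingType) (n m : nat) (P : {mpoly R[n + m]}) : Prop :=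
  exists G : 'I_m -> {mpoly R[n]},
    P = \sum_(i < m) 'X_(rshift n i) * x_embed m (G i).

Definition hilbert_IPS_proof (R : nzRingType) (cf : bool) (n : nat)
    (Fs : seq {mpoly R[n]}) (C : circuit R) : Prop :=
  circ_ok cf C /\ wf_circuit (n + size Fs) C /\
  @IPS_cert R n Fs (cpoly (n + size Fs) C) /\
  @hilbert_like R n (size Fs) (cpoly (n + size Fs) C).

Definition hilbert_IPS_superpoly (R : nzRingType) (cf : bool) (phi : nat -> cnf)
  : Prop :=
  ~ exists c : nat, forall n,
      exists C : circuit R,
        hilbert_IPS_proof cf (cnf_system R (phi n)) C /\
        (size C <= c * cnf_size (phi n) ^ c + c)%N /\
        (msize (cpoly (cnf_nv (phi n) + size (cnf_system R (phi n))) C)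
           <= c * cnf_size (phi n) ^ c + c)%N.

Inductive pc_step (F : Type) (n : nat) :=
| PAx of nat
| PLin of F & nat & F & nat
| PMulX of 'I_n & nat.

Definition pc_line (F : fieldType) (n : nat) (Fs : seq {mpoly F[n]})
    (lines : seq {mpoly F[n]}) (s : pc_step F n) : {mpoly F[n]} :=
  match s with
  | PAx i => nth 0 Fs i
  | PLin a j b l => a *: nth 0 lines j + b *: nth 0 lines l
  | PMulX v j => 'X_v * nth 0 lines j
  end.

Definition pc_lines (F : fieldType) (n : nat) (Fs : seq {mpoly F[n]})
    (D : seq (pc_step F n)) : seq {mpoly F[n]} :=
  foldl (fun lines s => rcons lines (pc_line Fs lines s)) [::] D.

Definition pc_step_ok (F : Type) (n m p : nat) (s : pc_step F n) : bool :=
  match s with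
  | PAx i => (i < m)%N
  | PLin _ j _ l => (j < p)%N && (l < p)%N
  | PMulX _ j => (j < p)%N
  end.

Definition PC_refutation (F : fieldType) (n : nat) (Fs : seq {mpoly F[n]})
    (D : seq (pc_step F n)) : Prop :=
  D <> [::] /\
  (forall p, (p < size D)%N -> pc_step_ok (size Fs) p (nth (PAx F n 0) D p)) /\
  last 0 (pc_lines Fs D) = 1.

Definition PC_superpoly (F : fieldType) (phi : nat -> cnf) : Prop :=
  ~ exists c : nat, forall n,
      exists D : seq (pc_step F (cnf_nv (phi n))),
        PC_refutation (cnf_system F (phi n)) D /\
        (size D <= c * cnf_size (phi n) ^ c + c)%N.

(* Main.v *)
Require Import Defs.
From HB Require Import structures.
From mathcomp Require Import all_boot all_order all_algebra.
From mathcomp Require Import mpoly.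
From mathcomp Require Import zify ring.
From Stdlib Require Import ClassicalEpsilon IndefiniteDescription.
Set Implicit Arguments. Unset Strict Implicit. Unset Printing Implicit Defensive.
Import GRing.Theory.
Local Open Scope ring_scope.

(* For a Boolean point [a], let [delta_a(x)] be the product over [j] of
   [a_j x_j + (1 - a_j) (1 - x_j)]; the sum of [delta_a] over all [a] is 1.  If
   [K_i] is the first clause falsified by [a], then [K_i(a) = 1], so [delta_a]
   equals [delta_a K_i(x)] plus an explicit combination of the axioms
   [x_j^2 - x_j].  Replacing clauses and axioms by placeholders and summing over
   [a] gives a Hilbert-like certificate which is an exponential sum of small
   constant-free formulas, hence is in VNP; if VNP = VP it has small circuits.
   A weakly skew Hilbert-like certificate is turned into a Polynomial Calculus
   refutation by evaluating it over dual numbers, where every placeholder is an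
   axiom times epsilon, and deriving the coordinates of all gates as lines. *)

(** * Polynomial bounds and formulas *)

Lemma leq_expn2r (c m n : nat) : (m <= n -> m ^ c <= n ^ c)%N.
Proof. by move=> mn; elim: c => // c IH; rewrite !expnS leq_mul. Qed.

(** With base [n.+1], which is at least 1, powers grow with the exponent and the additive constant
    is absorbed, so bounds combine by adding exponents. *)
Lemma polyb_shift (f : nat -> nat) :
  polyb f <-> exists c : nat, forall n, (f n <= c * n.+1 ^ c)%N.
Proof.
split=> -[c fP].
  exists (c + c)%N => n; apply: leq_trans (fP n) _.
  rewrite mulnDl leq_add //.
    by rewrite leq_mul ?leq_addr // (leq_trans (leq_expn2r _ (leqnSn n))) // leq_pexp2l // leq_addr.
  by rewrite leq_pmulr // expn_gt0.
(* The factor [2 ^ c] comes from [n.+1 <= 2 * n] for positive [n]; at [n = 0] the additive constant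
   suffices. *)
exists (c * 2 ^ c)%N => n; apply: leq_trans (fP n) _.
have [->|n_gt0] := posnP n.
  by rewrite exp1n muln1 (leq_trans _ (leq_addl _ _)) // leq_pmulr // expn_gt0.
apply: leq_trans (leq_addr _ _); rewrite -mulnA leq_mul2l; apply/orP; right.
have [->//|c_gt0] := posnP c.
apply: leq_trans (_ : (2 ^ c * n ^ c <= _)%N).
  by rewrite -expnMn leq_exp2r //; lia.
rewrite leq_mul2l leq_pexp2l ?orbT // leq_pmulr // expn_gt0 //.
Qed.

Lemma polyb_le (f g : nat -> nat) : (forall n, (f n <= g n)%N) -> polyb g -> polyb f.
Proof. by move=> fg [c gP]; exists c => n; apply: leq_trans (fg n) (gP n). Qed.

Lemma polyb_cst (a : nat) : polyb (fun=> a).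
Proof. by exists a => n; rewrite leq_addl. Qed.

Lemma polyb_id : polyb (fun n => n).
Proof. by exists 1 => n; rewrite expn1; lia. Qed.

Lemma polyb_add (f g : nat -> nat) : polyb f -> polyb g -> polyb (fun n => f n + g n)%N.
Proof.
rewrite !polyb_shift => -[c fP] [d gP]; exists (c + d)%N => n.
rewrite mulnDl leq_add //.
  by apply: leq_trans (fP n) _; rewrite leq_mul // leq_pexp2l // leq_addr.
by apply: leq_trans (gP n) _; rewrite leq_mul // leq_pexp2l // leq_addl.
Qed.

Lemma polyb_mul (f g : nat -> nat) : polyb f -> polyb g -> polyb (fun n => f n * g n)%N.
Proof.
rewrite !polyb_shift => -[c fP] [d gP]; exists (c * d + (c + d))%N => n.
apply: leq_trans (leq_mul (fP n) (gP n)) _.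
by rewrite mulnACA -expnD leq_mul ?leq_addr // leq_pexp2l // leq_addl.
Qed.

Lemma polyb_exp (f : nat -> nat) (d : nat) : polyb f -> polyb (fun n => f n ^ d)%N.
Proof.
move=> fP; elim: d => [|d IH]; first exact: polyb_cst.
by apply: polyb_le (polyb_mul fP IH) => n; rewrite expnS.
Qed.

Lemma poly_bound_weaken (a c d s : nat) :
  (c <= d)%N -> (a <= c * s ^ c + c)%N -> (a <= d * s ^ d + d)%N.
Proof.
move=> cd /leq_trans; apply.
have [->|s_gt0] := posnP s.
  case: c cd => [|c] cd; first by rewrite mul0n.
  by rewrite exp0n // muln0; lia.
by rewrite leq_add // leq_mul // leq_pexp2l.
Qed.

(** Trees, so that size bounds degree, with constants 0, 1 and -1 only, so that one formula makes
    sense in every ring and compiles to a constant-free circuit. *)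
Inductive expr :=
| EIn of nat
| EZero
| EOne
| EMone
| EAdd of expr & expr
| EMul of expr & expr.

Fixpoint eeval (A : nzRingType) (env : nat -> A) (e : expr) : A :=
  match e with
  | EIn i => env i
  | EZero => 0
  | EOne => 1
  | EMone => -1
  | EAdd a b => eeval env a + eeval env b
  | EMul a b => eeval env a * eeval env b
  end.

Fixpoint esize (e : expr) : nat :=
  match e with
  | EAdd a b | EMul a b => (esize a + esize b).+1
  | _ => 1
  end.

Fixpoint einputs (k : nat) (e : expr) : bool :=
  match e with
  | EIn i => (i < k)%N
  | EAdd a b | EMul a b => einputs k a && einputs k b
  | _ => true
  end.

(** A syntactic guarantee of being linear homogeneous in the inputs from [t] on: in a product only
    the right factor may contain them. *)
Fixpoint elinear (t : nat) (e : expr) : bool :=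
  match e with
  | EIn i => (t <= i)%N
  | EZero => true
  | EAdd a b => elinear t a && elinear t b
  | EMul a b => einputs t a && elinear t b
  | _ => false
  end.

Lemma esize_gt0 (e : expr) : (0 < esize e)%N. Proof. by case: e. Qed.

Lemma eeval_ext (A : nzRingType) (env1 env2 : nat -> A) (k : nat) (e : expr) :
  (forall i, (i < k)%N -> env1 i = env2 i) -> einputs k e -> eeval env1 e = eeval env2 e.
Proof.
by move=> env12; elim: e => //= [a IHa b IHb|a IHa b IHb] /andP[/IHa-> /IHb->].
Qed.

Lemma rmorph_eeval (A B : nzRingType) (g : {rmorphism A -> B}) (env : nat -> A) (e : expr) :
  g (eeval env e) = eeval (g \o env) e.
Proof.
elim: e => //= [||||].
- exact: rmorph0.
- exact: rmorph1.
- by rewrite rmorphN rmorph1.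
- by move=> a IHa b IHb; rewrite rmorphD IHa IHb.
- by move=> a IHa b IHb; rewrite rmorphM IHa IHb.
Qed.

(** The left factor of a product sees only inputs below [t], where every [u b] agrees with [env], so
    it is a common scalar. This yields the Hilbert-like form and, with [M = 0], the vanishing at
    zero placeholders. *)
Lemma eeval_linear (A : comNzRingType) (M t : nat) (env : nat -> A) (c : 'I_M -> A)
    (u : 'I_M -> nat -> A) (e : expr) :
  (forall b i, (i < t)%N -> u b i = env i) ->
  (forall i, (t <= i)%N -> env i = \sum_b c b * u b i) ->
  elinear t e -> eeval env e = \sum_b c b * eeval (u b) e.
Proof.
move=> ult uge; elim: e => //= [|a IHa b IHb|a IHa b IHb].
- by move=> _; rewrite big1 // => b _; rewrite mulr0.
- by move=> /andP[/IHa-> /IHb->]; rewrite -big_split; apply: eq_bigr => i _; rewrite mulrDr.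
move=> /andP[ain /IHb->]; rewrite mulr_sumr; apply: eq_bigr => i _.
by rewrite (eeval_ext (ult i) ain) mulrCA.
Qed.

Lemma msize_eeval (R : nzRingType) (k : nat) (env : nat -> {mpoly R[k]}) (e : expr) :
  (forall i, msize (env i) <= 2)%N -> (msize (eeval env e) <= 2 * esize e)%N.
Proof.
move=> envP; elim: e => //= [||||].
- by rewrite msize0.
- by rewrite msize1.
- by rewrite mmeasureN msize1.
- move=> a IHa b IHb; apply: leq_trans (mmeasureD_le _ _ _) _.
  by rewrite geq_max; apply/andP; split; [apply: leq_trans IHa _|apply: leq_trans IHb _]; lia.
- by move=> a IHa b IHb; apply: leq_trans (msizeM_le _ _) _; lia.
Qed.

(** [off] counts the gates already placed, so references are absolute; the output of each block is
    its last gate, whence the [.-1]. *)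
Fixpoint ecomp (R : nzRingType) (off : nat) (e : expr) : circuit R :=
  match e with
  | EIn i => [:: GIn i]
  | EZero => [:: GConst 0]
  | EOne => [:: GConst 1]
  | EMone => [:: GConst (-1)]
  | EAdd a b => ecomp R off a ++ ecomp R (off + esize a) b ++
      [:: GAdd (off + esize a).-1 (off + esize a + esize b).-1]
  | EMul a b => ecomp R off a ++ ecomp R (off + esize a) b ++
      [:: GMul (off + esize a).-1 (off + esize a + esize b).-1]
  end.

Lemma size_ecomp (R : nzRingType) (off : nat) (e : expr) : size (ecomp R off e) = esize e.
Proof. by elim: e off => //= a IHa b IHb off; rewrite !size_cat IHa IHb /=; lia. Qed.

Definition eval_from (R : nzRingType) (k : nat) (env : nat -> {mpoly R[k]})
    (vals : seq {mpoly R[k]}) (C : circuit R) : seq {mpoly R[k]} :=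
  foldl (fun vals g => rcons vals (eval_gate env vals g)) vals C.

Lemma nth_cat_rcons (T : Type) (x0 x : T) (u w v : seq T) :
  nth x0 (u ++ rcons w x ++ v) (size u + size w) = x.
Proof. by rewrite cat_rcons catA nth_cat size_cat ltnn subnn. Qed.

Lemma eval_from_ecomp (R : nzRingType) (k : nat) (env : nat -> {mpoly R[k]})
    (vals : seq {mpoly R[k]}) (e : expr) :
  exists2 ws, size ws = (esize e).-1
    & eval_from env vals (ecomp R (size vals) e) = vals ++ rcons ws (eeval env e).
Proof.
elim: e vals => [i||||a IHa b IHb|a IHa b IHb] vals /=.
- by exists [::]; rewrite // cats1.
- by exists [::]; rewrite // /eval_from /= cats1 mpolyC0.
- by exists [::]; rewrite // /eval_from /= cats1 mpolyC1.
- by exists [::]; rewrite // /eval_from /= cats1 mpolyCN mpolyC1.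
all: have [wa sza Ea] := IHa vals; have [wb szb Eb] := IHb (vals ++ rcons wa (eeval env a)).
all: exists (rcons wa (eeval env a) ++ rcons wb (eeval env b)).
all: rewrite ?size_cat ?size_rcons ?sza ?szb; have := esize_gt0 a; have := esize_gt0 b; try lia.
all: move=> b0 a0; rewrite size_cat size_rcons sza prednK // in Eb.
all: rewrite /eval_from in Ea Eb; rewrite /eval_from !foldl_cat /= Ea Eb -catA rcons_cat.
all: have -> : (size vals + esize a).-1 = (size vals + size wa)%N by lia.
all: have -> : (size vals + esize a + esize b).-1 = (size vals + (size wa).+1 + size wb)%N by lia.
all: have := nth_cat_rcons 0 (eeval env b) (vals ++ rcons wa (eeval env a)) wb [::].
all: by rewrite cats0 -catA size_cat size_rcons => ->; rewrite nth_cat_rcons.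
Qed.

Lemma eval_circ_ecomp (R : nzRingType) (k : nat) (env : nat -> {mpoly R[k]}) (e : expr) :
  eval_circ env (ecomp R 0 e) = eeval env e.
Proof.
have [ws _] := eval_from_ecomp env [::] e.
by rewrite /eval_circ /eval_vals /eval_from => ->; rewrite last_rcons.
Qed.

Lemma nth_ecomp_wf (R : nzRingType) (k off p : nat) (e : expr) :
  einputs k e -> (p < esize e)%N ->
  (forall j, j \in grefs (nth (GIn 0) (ecomp R off e) p) -> (j < off + p)%N) /\
  (forall i, nth (GIn 0) (ecomp R off e) p = GIn i -> (i < k)%N).
Proof.
elim: e off p => [i||||a IHa b IHb|a IHa b IHb] off p /=.
1-4: by case: p => //= ik _; split=> // j [<-].
all: move=> /andP[ka kb] lt_p; rewrite !nth_cat !size_ecomp.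
all: case: ltnP => [lt_pa|le_ap]; first exact: IHa.
all: case: ltnP => [lt_pb|le_bp].
all: try by have [H1 H2] := IHb (off + esize a)%N _ kb lt_pb; split=> // j /H1; lia.
all: have -> : (p - esize a - esize b = 0)%N by lia.
all: split=> //= j; rewrite !inE.
all: by have := esize_gt0 a; have := esize_gt0 b; lia.
Qed.

Lemma wf_ecomp (R : nzRingType) (k : nat) (e : expr) :
  einputs k e -> wf_circuit k (ecomp R 0 e).
Proof.
move=> ke; split; first by move/(congr1 size); rewrite size_ecomp; case: e {ke}.
by move=> p; rewrite size_ecomp => /(nth_ecomp_wf R 0 ke).
Qed.

Lemma constant_free_ecomp (R : nzRingType) (off : nat) (e : expr) :
  constant_free (ecomp R off e).
Proof.
rewrite /constant_free /gat; elim: e off => [i||||a IHa b IHb|a IHa b IHb] off p c /=.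
1-4: by case: p => //= _ [<-]; auto.
all: rewrite !size_cat !size_ecomp !nth_cat !size_ecomp /= => lt_p.
all: case: ltnP => [lt_pa|le_ap]; first by apply: IHa; rewrite size_ecomp.
all: case: ltnP => [lt_pb|le_bp];
  first by apply: (IHb (off + esize a)%N (p - esize a)%N); rewrite size_ecomp.
all: by case: (p - _ - _)%N => [|[]].
Qed.

Lemma circ_ok_ecomp (R : nzRingType) (cf : bool) (e : expr) : circ_ok cf (ecomp R 0 e).
Proof. by case: cf => //=; apply: constant_free_ecomp. Qed.

(** * The certificate formula *)

Definition eprod (es : seq expr) : expr := foldr EMul EOne es.

Definition esub (a b : expr) : expr := EAdd a (EMul EMone b).

Lemma eeval_eprod (A : nzRingType) (env : nat -> A) (es : seq expr) :
  eeval env (eprod es) = \prod_(e <- es) eeval env e.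
Proof. by elim: es => [|e es IH]; rewrite ?big_nil // big_cons -IH. Qed.

Lemma einputs_eprod (k : nat) (es : seq expr) : einputs k (eprod es) = all (einputs k) es.
Proof. by elim: es => //= e es ->. Qed.

Lemma esize_eprod (c : nat) (es : seq expr) :
  all (fun e => esize e <= c)%N es -> (esize (eprod es) <= c.+1 * size es + 1)%N.
Proof. by elim: es => [|e es IH] /=; [lia|case/andP=> ec /IH; lia]. Qed.

Section CertificateFormula.

Variable n : nat.
Implicit Types (l : 'I_n * bool) (cl : seq ('I_n * bool)) (cls : seq (seq ('I_n * bool))).

(* Inputs 0..n-1 are the summation variables [a_j], inputs n..2n-1 the
   variables [x_j], inputs 2n.. the placeholders: first those of the clauses,
   then those of the axioms [x_j^2 - x_j]. *)
Definition efac (j : 'I_n) : expr :=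
  EAdd (EMul (EIn j) (EIn (n + j))) (EMul (esub EOne (EIn j)) (esub EOne (EIn (n + j)))).

Definition elit (off : nat) l : expr :=
  if l.2 then esub EOne (EIn (off + l.1)) else EIn (off + l.1).

Definition eclause (off : nat) cl : expr := eprod [seq elit off l | l <- cl].

(** The value is [1 - 2 a_j] up to sign: a positive literal, with polynomial [1 - X], reverses the
    difference of its values at [a] and [x]. *)
Definition esign l : expr :=
  if l.2 then esub (EAdd (EIn l.1) (EIn l.1)) EOne
  else esub EOne (EAdd (EIn l.1) (EIn l.1)).

Definition eothers (j : 'I_n) : expr := eprod [seq efac i | i <- enum 'I_n & i != j].

Definition edelta : expr := eprod [seq efac i | i <- enum 'I_n].

(* Write [K] for the clause polynomial and [delta] for the value of [edelta].
   When the placeholders carry the Boolean axioms, the value of [ecorr] is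
   [delta * (K(a) - K(x))], telescoped literal by literal through
   [delta * (a_j - x_j) = (1 - 2 a_j) (x_j^2 - x_j) \prod_(i != j) fac_i]. *)
Fixpoint ecorr (zoff : nat) cl : expr :=
  match cl with
  | [::] => EZero
  | l :: cl' =>
    EAdd (EMul (EMul (eclause 0 cl') (EMul (eothers l.1) (esign l))) (EIn (zoff + l.1)))
         (EMul (elit n l) (ecorr zoff cl'))
  end.

(* The Horner-style recursion selects the first clause falsified by [a]. *)
Fixpoint ecert (zoff i : nat) cls : expr :=
  match cls with
  | [::] => EZero
  | cl :: cls' =>
    EAdd (EMul (eclause 0 cl) (EAdd (EMul edelta (EIn (n + n + i))) (ecorr zoff cl)))
         (EMul (esub EOne (eclause 0 cl)) (ecert zoff i.+1 cls'))
  end.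

Lemma esize_eclause (off : nat) cl : (esize (eclause off cl) <= 6 * size cl + 1)%N.
Proof.
rewrite -(size_map (elit off)); apply: esize_eprod; rewrite all_map.
by apply/allP => -[j []].
Qed.

Lemma esize_eothers (j : 'I_n) : (esize (eothers j) <= 16 * n + 1)%N.
Proof.
apply: leq_trans (_ : (_ <= 16 * size [seq efac i | i <- enum 'I_n & i != j] + 1)%N) _.
  by apply: esize_eprod; rewrite all_map; apply/allP.
rewrite leq_add2r leq_mul2l /= size_map size_filter -[X in (_ <= X)%N](size_enum_ord n).
exact: count_size.
Qed.

Lemma esize_edelta : (esize edelta <= 16 * n + 1)%N.
Proof.
rewrite -[X in (_ <= 16 * X + _)%N]size_enum_ord -(size_map efac); apply: esize_eprod.
by rewrite all_map; apply/allP.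
Qed.

Lemma esize_ecorr (zoff : nat) cl :
  (esize (ecorr zoff cl) <= (6 * size cl + 16 * n + 30) * size cl + 1)%N.
Proof.
elim: cl => [|l cl IH] /=; first by rewrite muln0.
have := esize_eclause 0 cl; have := esize_eothers l.1.
have : (esize (esign l) <= 9)%N by case: l => ? [].
have : (esize (elit n l) <= 5)%N by case: l => ? [].
have -> : ((6 * (size cl).+1 + 16 * n + 30) * (size cl).+1 =
  (6 * size cl + 16 * n + 30) * size cl + (12 * size cl + 16 * n + 36))%N by ring.
by move: (_ * size cl)%N IH => m; lia.
Qed.

Lemma esize_ecert (zoff i s : nat) cls :
  (n <= s)%N -> all (fun cl => size cl <= s)%N cls ->
  (esize (ecert zoff i cls) <= 60 * s.+1 ^ 2 * size cls + 1)%N.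
Proof.
move=> ns; elim: cls i => [|cl cls IH] i /=; first by rewrite muln0.
move=> /andP[cls_s /IH{}IH].
have := esize_eclause 0 cl; have := esize_edelta; have := esize_ecorr zoff cl.
have {IH} := IH i.+1; rewrite mulnS.
have : ((6 * size cl + 16 * n + 30) * size cl <= (22 * s + 30) * s)%N.
  by apply: leq_mul; lia.
have : (60 * s.+1 ^ 2 = 22 * s * s + 30 * s + (38 * s * s + 90 * s + 60))%N by ring.
by nia.
Qed.

Lemma einputs_elit (off k : nat) l : (off + n <= k)%N -> einputs k (elit off l).
Proof. by move=> le_k; case: l => j [] /=; have := ltn_ord j; lia. Qed.

Lemma einputs_eclause (off k : nat) cl : (off + n <= k)%N -> einputs k (eclause off cl).
Proof.
move=> le_k; rewrite /eclause einputs_eprod all_map.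
by apply/allP => l _ /=; apply: einputs_elit.
Qed.

Lemma einputs_efac (k : nat) (j : 'I_n) : (n + n <= k)%N -> einputs k (efac j).
Proof. by move=> le_k /=; have := ltn_ord j; lia. Qed.

Lemma einputs_eothers (k : nat) (j : 'I_n) : (n + n <= k)%N -> einputs k (eothers j).
Proof.
move=> le_k; rewrite /eothers einputs_eprod all_map.
by apply/allP => i _; apply: einputs_efac.
Qed.

Lemma einputs_edelta (k : nat) : (n + n <= k)%N -> einputs k edelta.
Proof.
move=> le_k; rewrite /edelta einputs_eprod all_map.
by apply/allP => i _; apply: einputs_efac.
Qed.

Lemma einputs_esign (k : nat) l : (n <= k)%N -> einputs k (esign l).
Proof. by move=> le_k; case: l => j [] /=; have := ltn_ord j; lia. Qed.

Lemma einputs_ecorr (k zoff : nat) cl :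
  (n + n <= k)%N -> (zoff + n <= k)%N -> einputs k (ecorr zoff cl).
Proof.
move=> le_k le_zk; elim: cl => [//|l cl IH] /=.
rewrite einputs_eclause ?einputs_eothers ?einputs_esign ?einputs_elit ?IH //; try lia.
by have := ltn_ord l.1; lia.
Qed.

Lemma elinear_ecorr (zoff : nat) cl : (n + n <= zoff)%N -> elinear (n + n) (ecorr zoff cl).
Proof.
move=> le_z; elim: cl => [//|l cl IH] /=.
by rewrite einputs_eclause ?einputs_eothers ?einputs_esign ?einputs_elit ?IH //; lia.
Qed.

Lemma einputs_ecert (k zoff i : nat) cls :
  (zoff + n <= k)%N -> (n + n + i + size cls <= k)%N -> einputs k (ecert zoff i cls).
Proof.
move=> le_zk; elim: cls i => [//|cl cls IH] i /= le_k.
by rewrite !einputs_eclause ?einputs_edelta ?einputs_ecorr ?IH //; lia.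
Qed.

Lemma elinear_ecert (zoff i : nat) cls :
  (n + n <= zoff)%N -> elinear (n + n) (ecert zoff i cls).
Proof.
move=> le_z; elim: cls i => [//|cl cls IH] i /=.
by rewrite !einputs_eclause ?einputs_edelta ?elinear_ecorr ?IH //; lia.
Qed.

(** * Evaluation of the certificate formula at a Boolean point *)

Section Semantics.

Variables (A : comNzRingType) (env : nat -> A) (a : 'I_n -> bool) (zoff : nat).
Hypothesis env_a : forall j : 'I_n, env j = (a j)%:R.
Hypothesis env_z : forall j : 'I_n, env (zoff + j)%N = env (n + j)%N ^+ 2 - env (n + j)%N.

Lemma eeval_eclause_bool cl :
  eeval env (eclause 0 cl) = (all (fun l => a l.1 != l.2) cl)%:R.
Proof.
rewrite /eclause eeval_eprod big_map; elim: cl => [|l cl IH]; first by rewrite big_nil.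
rewrite big_cons IH /elit; case: l => j [] /=; rewrite env_a; case: (a j) => /=.
all: by rewrite ?mulr0 ?mulr1 ?add0r ?addr0 ?mul0r ?mul1r ?subrr ?addrN ?mul0r //; ring.
Qed.

Lemma eeval_edelta : eeval env edelta = \prod_j eeval env (efac j).
Proof. by rewrite /edelta eeval_eprod big_map big_enum. Qed.

(** Only the factor at [j] matters: times [a_j - x_j] it is [x_j^2 - x_j] if [a_j = 0] and the
    opposite if [a_j = 1]. *)
Lemma eeval_edelta_sub (j : 'I_n) :
  eeval env edelta * (env j - env (n + j)%N) =
  eeval env (eothers j) * (1 - (env j + env j)) * env (zoff + j)%N.
Proof.
rewrite eeval_edelta (bigD1 j) //= /eothers eeval_eprod big_map big_filter big_enum_cond /=.
by rewrite env_z env_a; case: (a j) => /=; ring.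
Qed.

Lemma eeval_ecorr cl :
  eeval env (ecorr zoff cl) =
  eeval env edelta * (eeval env (eclause 0 cl) - eeval env (eclause n cl)).
Proof.
elim: cl => [|l cl IH]; first by rewrite /= subrr mulr0.
have Ediff : eeval env edelta * (eeval env (elit 0 l) - eeval env (elit n l)) =
    eeval env (eothers l.1) * eeval env (esign l) * env (zoff + l.1)%N.
  have := eeval_edelta_sub l.1; rewrite /elit /esign; case: l.2 => /= H; rewrite add0n.

    by transitivity (- (eeval env edelta * (env l.1 - env (n + l.1)%N))); [ring | rewrite H; ring].
  by rewrite mulN1r.
(* The product rule for differences: [l0 c0 - ln cn = c0 (l0 - ln) + ln (c0 - cn)]. *)
have telescope (d l0 ln o s z c0 cn : A) : d * (l0 - ln) = o * s * z ->
    c0 * (o * s) * z + ln * (d * (c0 - cn)) = d * (l0 * c0 - ln * cn).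
  by move=> H; rewrite -[c0 * _ * z]mulrA -H; ring.
have /= := telescope _ _ _ _ _ _ (eeval env (eclause 0 cl)) (eeval env (eclause n cl)) Ediff.
by rewrite -IH.
Qed.

Lemma eeval_ecert (i : nat) cls :
  (forall b, (b < size cls)%N ->
     env (n + n + (i + b))%N = eeval env (eclause n (nth [::] cls b))) ->
  (exists2 cl, cl \in cls & forall l, l \in cl -> a l.1 != l.2) ->
  eeval env (ecert zoff i cls) = eeval env edelta.
Proof.
elim: cls i => [|cl cls IH] i env_y [cl0 cl0_in cl0P]; first by [].
set d := edelta; set c0 := eclause 0 cl.
rewrite -[ecert _ _ _]/(EAdd (EMul c0 (EAdd (EMul d (EIn (n + n + i))) (ecorr zoff cl)))
  (EMul (esub EOne c0) (ecert zoff i.+1 cls))).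
rewrite [LHS]/= eeval_ecorr -/d -/c0.
have := env_y 0%N isT; rewrite addn0 => -> /=.
rewrite mulN1r; have Ec0 : eeval env c0 = _ := eeval_eclause_bool cl.
(* A falsified head clause has value 1 at [a], and its term is [delta K(x) + delta (1 - K(x))]; a
   satisfied one has value 0, and only the tail survives. *)
case: allP Ec0 => [_ ->|ncl ->]; first by rewrite /=; ring.
rewrite IH; first by rewrite /=; ring.
  by move=> b lt_b; rewrite addSnnS; apply: (env_y b.+1).
exists cl0 => //; move: cl0_in; rewrite inE => /predU1P[E|//].
by case: ncl; rewrite -E.
Qed.

End Semantics.

(** The factor at [j] is [x_j] or [1 - x_j] according to [a_j], so distributivity turns the sum of
    products into the product of all [x_j + (1 - x_j)]. *)
Lemma sum_edelta (A : comNzRingType) (x : 'I_n -> A) (env : {ffun 'I_n -> bool} -> nat -> A) :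
  (forall a (j : 'I_n), env a j = (a j)%:R) ->
  (forall a (j : 'I_n), env a (n + j)%N = x j) ->
  \sum_a eeval (env a) edelta = 1.
Proof.
move=> env_a env_x; pose F j (b : bool) : A := if b then x j else 1 - x j.
transitivity (\sum_(a : {ffun 'I_n -> bool}) \prod_j F j (a j)).
  apply: eq_bigr => a _; rewrite eeval_edelta; apply: eq_bigr => j _ /=.
  by rewrite env_a env_x /F; case: (a j) => /=; ring.
rewrite -bigA_distr_bigA /=; apply: big1 => j _.
by rewrite big_bool /F /=; ring.
Qed.

End CertificateFormula.

(** * The certificate polynomial and its membership in VNP *)

Section Certificate.

Variables (R : comNzRingType) (phi : cnf).
Let n := cnf_nv phi.
Let cls := cnf_clauses phi.
Let Fs := cnf_system R phi.

Lemma size_cnf_system : size (cnf_system R phi) = (size cls + n)%N.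
Proof. by rewrite size_cat 2!size_map size_enum_ord. Qed.

Definition ips_formula : expr := ecert (n + n + size cls) 0 cls.

Definition ips_poly : {mpoly R[n + size Fs]} :=
  \sum_(a : {ffun 'I_n -> bool}) eeval (@sum_env R n (n + size Fs) a) ips_formula.

Lemma einputs_ips_formula : einputs (n + (n + size Fs)) ips_formula.
Proof. by apply: einputs_ecert; rewrite size_cnf_system; lia. Qed.

Lemma elinear_ips_formula : elinear (n + n) ips_formula.
Proof. by apply: elinear_ecert; lia. Qed.

Lemma esize_ips_formula : (esize ips_formula <= 60 * (cnf_size phi).+1 ^ 3 + 1)%N.
Proof.
have le_s : all (fun cl => size cl <= cnf_size phi)%N cls.
  apply/allP => cl cl_in; rewrite /cnf_size; apply: leq_trans (leq_addl _ _).
  by rewrite sumnE big_map (big_rem cl) //= leq_addr.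
apply: leq_trans (esize_ecert _ _ _ le_s) _; first by rewrite /cnf_size -/n; lia.
rewrite leq_add2r [in X in (_ <= X)%N]expnSr mulnA leq_mul2l; apply/orP; right.
by rewrite /cnf_size -/cls; lia.
Qed.

(* The environment of the summand at [a], seen through a substitution of the
   placeholders by [y]. *)
Definition cert_env (k : nat) (x : 'I_n -> {mpoly R[k]}) (y : nat -> {mpoly R[k]})
    (a : {ffun 'I_n -> bool}) (i : nat) : {mpoly R[k]} :=
  if (i < n)%N then oapp (fun o : 'I_n => (a o)%:R) 0 (insub i)
  else if (i - n < n)%N then oapp x 0 (insub (i - n)%N) else y (i - n - n)%N.

Section CertEnv.

Variables (k : nat) (x : 'I_n -> {mpoly R[k]}) (y : nat -> {mpoly R[k]}).
Variable a : {ffun 'I_n -> bool}.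

Lemma cert_env_a (j : 'I_n) : cert_env x y a j = (a j)%:R.
Proof. by rewrite /cert_env ltn_ord valK. Qed.

Lemma cert_env_x (j : 'I_n) : cert_env x y a (n + j) = x j.
Proof. by rewrite /cert_env ltnNge leq_addr addKn ltn_ord valK. Qed.

Lemma cert_env_y (b : nat) : cert_env x y a (n + n + b) = y b.
Proof.
rewrite /cert_env -addnA ltnNge leq_addr addKn.
by rewrite ltnNge leq_addr addKn.
Qed.

End CertEnv.

Lemma sum_env_cert (a : {ffun 'I_n -> bool}) (i : nat) :
  sum_env R (n + size Fs) a i =
  cert_env (fun j => 'X_(lshift (size Fs) j))
    (fun b => oapp (fun o : 'I_(size Fs) => 'X_(rshift n o)) 0 (insub b)) a i.
Proof.
rewrite /sum_env /cert_env; case: ltnP => // le_ni; rewrite /var_env.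
case: ltnP => [lt_in|le_nin].
  have lt_iM : (i - n < n + size Fs)%N by apply: leq_trans lt_in (leq_addr _ _).
  by rewrite !insubT //=; congr 'X_(_); apply: val_inj.
have [lt_iM|le_Mi] := ltnP (i - n - n) (size Fs); last first.
  by rewrite !insubF //; apply/negbTE; rewrite -leqNgt //; lia.
have lt_iM' : (i - n < n + size Fs)%N by lia.
by rewrite !insubT //=; congr 'X_(_); apply: val_inj => /=; lia.
Qed.

Lemma rmorph_ips_poly (k : nat) (g : {rmorphism {mpoly R[n + size Fs]} -> {mpoly R[k]}}) :
  g ips_poly = \sum_a eeval (cert_env (fun j => g 'X_(lshift (size Fs) j))
    (fun b => oapp (fun o : 'I_(size Fs) => g 'X_(rshift n o)) 0 (insub b)) a) ips_formula.
Proof.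
rewrite /ips_poly rmorph_sum; apply: eq_bigr => a _; rewrite rmorph_eeval.
apply: eeval_ext einputs_ips_formula => i _ /=; rewrite sum_env_cert /cert_env.
case: ifP => _; first by case: insubP => [o _ _|_] /=; rewrite ?rmorph_nat ?rmorph0.
by case: ifP => _; case: insubP => [o _ _|_] //=; rewrite rmorph0.
Qed.

Lemma comp_mpolyX_subst_y (ys : 'I_(size Fs) -> {mpoly R[n]}) (i : 'I_(n + size Fs)) :
  'X_i \mPo @subst_y R n Fs ys = match split i with inl a => 'X_a | inr b => ys b end.
Proof. by rewrite comp_mpolyXU -tnth_nth tnth_mktuple. Qed.

Lemma split_lshift (m k : nat) (i : 'I_m) : split (lshift k i) = inl i.
Proof. exact: (@unsplitK m k (inl i)). Qed.

Lemma split_rshift (m k : nat) (i : 'I_k) : split (rshift m i) = inr i.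
Proof. exact: (@unsplitK m k (inr i)). Qed.

Lemma comp_ips_poly_subst_y (ys : 'I_(size Fs) -> {mpoly R[n]}) :
  ips_poly \mPo @subst_y R n Fs ys =
  \sum_a eeval (cert_env (fun j => 'X_j) (fun b => oapp ys 0 (insub b)) a) ips_formula.
Proof.
rewrite (rmorph_ips_poly (comp_mpoly (@subst_y R n Fs ys))); apply: eq_bigr => a _.
apply: eeval_ext einputs_ips_formula => i _; rewrite /cert_env.
case: ifP => // _; case: ifP => _.
  by case: insubP => //= o _ _; rewrite comp_mpolyX_subst_y split_lshift.
by case: insubP => //= o _ _; rewrite comp_mpolyX_subst_y split_rshift.
Qed.

Lemma eeval_eclause_poly (env : nat -> {mpoly R[n]}) (cl : seq ('I_n * bool)) :
  (forall j : 'I_n, env (n + j)%N = 'X_j) -> eeval env (eclause n cl) = clause_poly R cl.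
Proof.
move=> env_x; rewrite /eclause eeval_eprod big_map; apply: eq_bigr => -[j []] _ /=.
  by rewrite env_x mulN1r.
by rewrite env_x.
Qed.

Lemma ips_poly_unsat : cnf_unsat phi ->
  ips_poly \mPo @subst_y R n Fs (fun b => nth 0 Fs b) = 1.
Proof.
move=> unsat; rewrite comp_ips_poly_subst_y.
set env := cert_env _ _.
have env_y a b : (b < size Fs)%N -> env a (n + n + b)%N = nth 0 Fs b.
  by move=> lt_b; rewrite /env cert_env_y insubT.
rewrite -[RHS](@sum_edelta n _ (fun j => 'X_j) env); first last.
- by move=> a j; rewrite /env cert_env_x.
- by move=> a j; rewrite /env cert_env_a.
apply: eq_bigr => a _; apply: (@eeval_ecert _ _ _ a).
- by move=> j; rewrite /env cert_env_a.
(* Axiom placeholders follow those of the clauses, so [nth] skips the clause part and lands on the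
   axiom of [x_j]. *)
- move=> j; rewrite -addnA env_y; last by rewrite size_cnf_system ltn_add2l.
  rewrite /env cert_env_x nth_cat size_map ltnNge leq_addr addKn.
  by rewrite (nth_map j) ?size_enum_ord // nth_ord_enum.
- move=> b lt_b; rewrite add0n env_y; last by rewrite size_cnf_system ltn_addr.
  rewrite nth_cat size_map lt_b (nth_map [::]) // eeval_eclause_poly //.
  by move=> j; rewrite /env cert_env_x.
- exact: unsat.
Qed.

Lemma ips_poly_y0 : ips_poly \mPo @subst_y R n Fs (fun=> 0) = 0.
Proof.
rewrite comp_ips_poly_subst_y big1 // => a _.
(* With all placeholders zero, linearity applies with an empty index set, and the sum of no terms is
   0. *)
rewrite (@eeval_linear _ 0 (n + n) _ (fun=> 0) (fun=> fun=> 0)) ?big_ord0 ?elinear_ips_formula //.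
  by case.
move=> i le_i; rewrite -(subnKC le_i) cert_env_y.
by case: insubP.
Qed.

Lemma hilbert_like_ips_poly : @hilbert_like R n (size Fs) ips_poly.
Proof.
(* The coefficient of placeholder [b]: by linearity, the value with [b] set to 1 and the other
   placeholders to 0. *)
pose G (b : 'I_(size Fs)) : {mpoly R[n]} :=
  \sum_a eeval (cert_env (fun j => 'X_j) (fun i => (i == b)%:R) a) ips_formula.
exists G.
pose u (a : {ffun 'I_n -> bool}) (b : 'I_(size Fs)) :=
  cert_env (fun j => 'X_(lshift (size Fs) j) : {mpoly R[n + size Fs]}) (fun i => (i == b)%:R) a.
transitivity (\sum_b \sum_a 'X_(rshift n b) * eeval (u a b) ips_formula).
  rewrite exchange_big; apply: eq_bigr => a _.
  apply: (@eeval_linear _ _ (n + n)) elinear_ips_formula => [b i lt_i|i le_i].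
    rewrite sum_env_cert /u /cert_env; case: ltnP => // le_ni.
    by rewrite (_ : i - n < n)%N //; lia.
  rewrite sum_env_cert -(subnKC le_i) cert_env_y.
  under eq_bigr do rewrite /u cert_env_y.
  case: insubP => [o _ /= <-|ge_i] /=.
    rewrite (bigD1 o) //= eqxx mulr1 big1 ?addr0 // => b ne_bo.
    by rewrite (inj_eq val_inj) eq_sym (negbTE ne_bo) mulr0.
  rewrite big1 // => b _; case: eqP => [E|_]; last by rewrite mulr0.
  by rewrite E ltn_ord in ge_i.
apply: eq_bigr => b _; rewrite -mulr_sumr; congr (_ * _).
rewrite /x_embed /G rmorph_sum; apply: eq_bigr => a _ /=; rewrite rmorph_eeval.
apply: eeval_ext einputs_ips_formula => i _ /=; rewrite /u /cert_env.
case: ifP => _; first by case: insubP => [o _ _|_] /=; rewrite ?rmorph_nat ?rmorph0.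
case: ifP => _; last by rewrite rmorph_nat.
by case: insubP => [o _ _|_] /=; rewrite ?rmorph0 // comp_mpolyXU -tnth_nth tnth_mktuple.
Qed.

Lemma msize_var_env (k i : nat) : (msize (var_env R k i) <= 2)%N.
Proof. by rewrite /var_env; case: insubP => [o _ _|_] /=; rewrite ?msize0 // msizeX mdeg1. Qed.

Lemma msize_ips_poly : (msize ips_poly <= 2 * esize ips_formula)%N.
Proof.
apply: leq_trans (msize_sum _ _ _) _; apply/bigmax_leqP => a _.
apply: msize_eeval => i; rewrite /sum_env; case: ifP => _; last exact: msize_var_env.
case: insubP => [o _ _|_] /=; last by rewrite msize0.
by case: (a o); rewrite ?msize1 ?msize0.
Qed.

Lemma msize_ips_circuit :
  (msize (cpoly (n + (n + size Fs)) (ecomp R 0 ips_formula)) <= 2 * esize ips_formula)%N.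
Proof.
rewrite /cpoly eval_circ_ecomp; apply: msize_eeval => i; exact: msize_var_env.
Qed.

End Certificate.

(** The summation variables are the coordinates of the Boolean point; the cubic bound on the formula
    controls both circuit size and degree. *)
Lemma VNPc_ips_poly (R : comNzRingType) (cf : bool) (psi : nat -> cnf) :
  polyb (fun N => cnf_size (psi N)) -> VNPc cf (fun N => ips_poly R (psi N)).
Proof.
move=> psiP; have esP : polyb (fun N => esize (ips_formula (psi N))).
  apply: polyb_le (fun N => esize_ips_formula (psi N)) _.
  apply: polyb_add (polyb_cst 1); apply: polyb_mul (polyb_cst 60) _; apply: polyb_exp.
  by apply: polyb_le (polyb_add (polyb_cst 1) psiP).
have nvP : polyb (fun N => cnf_nv (psi N)).
  by apply: polyb_le psiP => N; rewrite /cnf_size; lia.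
split; [|split].
- apply: polyb_le (polyb_add (polyb_add nvP nvP) psiP) => N.
  by rewrite size_cnf_system /cnf_size; lia.
- by apply: polyb_le (fun N => msize_ips_poly R (psi N)) (polyb_mul (polyb_cst 2) esP).
exists (fun N => cnf_nv (psi N)), (fun N => ecomp R 0 (ips_formula (psi N))).
split=> //; split; first by apply: polyb_le esP => N; rewrite size_ecomp.
split.
  by apply: polyb_le (fun N => msize_ips_circuit R (psi N)) (polyb_mul (polyb_cst 2) esP).
move=> N; split; first exact: circ_ok_ecomp.
split; first exact: wf_ecomp (einputs_ips_formula R (psi N)).
by apply: eq_bigr => a _; rewrite eval_circ_ecomp.
Qed.

Lemma VPc_hilbert_IPS (R : comNzRingType) (cf : bool) (psi : nat -> cnf) :
  (forall N, cnf_unsat (psi N)) -> VPc cf (fun N => ips_poly R (psi N)) ->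
  exists c : nat, forall N, exists C : circuit R,
    hilbert_IPS_proof cf (cnf_system R (psi N)) C /\
    (size C <= c * N ^ c + c)%N /\
    (msize (cpoly (cnf_nv (psi N) + size (cnf_system R (psi N))) C) <= c * N ^ c + c)%N.
Proof.
move=> unsat [_ [[c1 degP] [C [[c2 sizeP] CP]]]].
exists (maxn c1 c2) => N; have [okC [wfC EC]] := CP N.
exists (C N); rewrite /hilbert_IPS_proof EC; split; last first.
  by split; [apply: poly_bound_weaken (sizeP N)|apply: poly_bound_weaken (degP N)];
    rewrite leq_max leqnn ?orbT.
do 2!split=> //; split; last exact: hilbert_like_ips_poly.
by split; [apply: ips_poly_y0|apply: ips_poly_unsat].
Qed.

(** * Weakly skew certificates and Polynomial Calculus *)

Lemma rmorph_mpoly_ext (R : comNzRingType) (n : nat) (A : nzRingType)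
    (g1 g2 : {rmorphism {mpoly R[n]} -> A}) :
  (forall c, g1 c%:MP = g2 c%:MP) -> (forall i, g1 'X_i = g2 'X_i) -> g1 =1 g2.
Proof.
move=> gC gX p; rewrite (mpolyE p) !rmorph_sum; apply: eq_bigr => m _ /=.
rewrite -mul_mpolyC !rmorphM gC mpolyXE_id !rmorph_prod; congr (_ * _).
by apply: eq_bigr => i _; rewrite !rmorphXn gX.
Qed.

Lemma size_eval_vals (R : nzRingType) (k : nat) (env : nat -> {mpoly R[k]}) (C : circuit R) :
  size (eval_vals env C) = size C.
Proof.
elim/last_ind: C => // C g IH.
by rewrite /eval_vals -cats1 foldl_cat /= !size_rcons size_cat /= addn1 -IH.
Qed.

(** The list of values only grows and references point backwards, so the equation of a gate, valid
    when its value is appended, persists in the final list. *)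
Lemma nth_eval_vals (R : nzRingType) (k : nat) (env : nat -> {mpoly R[k]}) (C : circuit R) :
  (forall p, (p < size C)%N -> forall j, j \in grefs (gat C p) -> (j < p)%N) ->
  forall p, (p < size C)%N ->
    nth 0 (eval_vals env C) p = eval_gate env (eval_vals env C) (gat C p).
Proof.
elim/last_ind: C => // C g IH refs_lt p.
have E : eval_vals env (rcons C g) = rcons (eval_vals env C) (eval_gate env (eval_vals env C) g).
  by rewrite /eval_vals -cats1 foldl_cat.
have sz := size_eval_vals env C.
have gate_rcons q : (q <= size C)%N -> (forall j, j \in grefs (gat (rcons C g) q) -> (j < q)%N) ->
    eval_gate env (eval_vals env (rcons C g)) (gat (rcons C g) q) =
    eval_gate env (eval_vals env C) (gat (rcons C g) q).
  move=> le_q; case: (gat _ _) => //= j l lt_q; rewrite E !nth_rcons sz.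
  1-2: by rewrite !(leq_trans _ le_q) //; apply: lt_q; rewrite !inE eqxx ?orbT.
rewrite size_rcons ltnS => le_p; rewrite gate_rcons //; last first.
  by apply: refs_lt; rewrite size_rcons ltnS.
rewrite E nth_rcons sz; case: ltngtP le_p => // [lt_p|->] _; last first.
  by rewrite /gat nth_rcons ltnn eqxx.
rewrite IH // => [|q lt_q j]; first by rewrite /gat nth_rcons lt_p.
move=> j_q; apply: (refs_lt q); first by rewrite size_rcons ltnS ltnW.
by rewrite /gat nth_rcons lt_q.
Qed.

Section PolynomialCalculus.

Variables (F : fieldType) (n : nat) (Fs : seq {mpoly F[n]}).
Notation m := (size Fs).
Implicit Types (ls ts : seq {mpoly F[n]}) (h : {poly {mpoly F[n]}}).

Definition pc_sequence ls : Prop :=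
  exists2 D : seq (pc_step F n),
    (forall p, (p < size D)%N -> pc_step_ok m p (nth (PAx F n 0) D p)) & pc_lines Fs D = ls.

(** The rules are phrased by membership rather than position, so that appending lines preserves
    them. *)
Definition pc_next ls (q : {mpoly F[n]}) : Prop :=
  [\/ q \in Fs,
      exists a G b H, [/\ G \in ls, H \in ls & q = a *: G + b *: H]
    | exists v G, G \in ls /\ q = 'X_v * G].

Lemma pc_lines_rcons (D : seq (pc_step F n)) s :
  pc_lines Fs (rcons D s) = rcons (pc_lines Fs D) (pc_line Fs (pc_lines Fs D) s).
Proof. by rewrite /pc_lines -cats1 foldl_cat. Qed.

Lemma size_pc_lines (D : seq (pc_step F n)) : size (pc_lines Fs D) = size D.
Proof. by elim/last_ind: D => // D s IH; rewrite pc_lines_rcons !size_rcons IH. Qed.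

Lemma pc_sequence_rcons ls q : pc_sequence ls -> pc_next ls q -> pc_sequence (rcons ls q).
Proof.
move=> [D okD <-] next.
suff [s ok_s Es] : exists2 s, pc_step_ok m (size D) s & q = pc_line Fs (pc_lines Fs D) s.
  exists (rcons D s); last by rewrite pc_lines_rcons Es.
  move=> p; rewrite size_rcons ltnS nth_rcons => le_p.
  by case: ltngtP le_p => // [lt_p|->] _; [apply: okD|].
case: next => [q_in|[a [G [b [H [G_in H_in Eq]]]]]|[v [G [G_in Eq]]]].
- exists (PAx F n (index q Fs)); first by rewrite /= index_mem.
  by rewrite /= nth_index.
- exists (PLin n a (index G (pc_lines Fs D)) b (index H (pc_lines Fs D))).
    by rewrite /= -size_pc_lines !index_mem G_in.
  by rewrite /= !nth_index.
- exists (PMulX F v (index G (pc_lines Fs D))); first by rewrite /= -size_pc_lines index_mem.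
  by rewrite /= nth_index.
Qed.

Lemma pc_next_sub ls ls' q : {subset ls <= ls'} -> pc_next ls q -> pc_next ls' q.
Proof.
move=> sub [q_in|[a [G [b [H [G_in H_in Eq]]]]]|[v [G [G_in Eq]]]].
- by constructor 1.
- by constructor 2; exists a, G, b, H; split=> //; apply: sub.
- by constructor 3; exists v, G; split=> //; apply: sub.
Qed.

Lemma pc_sequence_cat ls ts :
  pc_sequence ls -> (forall t, t \in ts -> pc_next ls t) -> pc_sequence (ls ++ ts).
Proof.
move=> okls; elim/last_ind: ts => [|ts t IH] next; first by rewrite cats0.
rewrite -rcons_cat; apply: pc_sequence_rcons.
  by apply: IH => u u_in; apply: next; rewrite mem_rcons inE u_in orbT.
apply: (@pc_next_sub ls) (next t _); last by rewrite mem_rcons inE eqxx.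
by move=> u u_in; rewrite mem_cat u_in.
Qed.

(* A polynomial [h] is read modulo ['X ^+ 2]: a state holds the lines
   [f * h_0], [f] an axiom, which multiplication by a placeholder turns into
   the linear part, and the line [h_1]. *)
Definition state h : seq {mpoly F[n]} := h`_1 :: [seq f * h`_0 | f <- Fs].

Lemma size_state h : size (state h) = m.+1.
Proof. by rewrite /= size_map. Qed.

(** ['X] stands for epsilon; no quotient is formed, as a state reads only the coefficients 0 and
    1. *)
Definition dual_env (i : nat) : {poly {mpoly F[n]}} :=
  if (i < n)%N then (var_env F n i)%:P else (nth 0 Fs (i - n))%:P * 'X.

Lemma pc_next_scale ls G c : G \in ls -> pc_next ls (c *: G).
Proof. by move=> G_in; constructor 2; exists c, G, 0, G; rewrite scale0r addr0. Qed.

Lemma pc_next_mem ls G : G \in ls -> pc_next ls G.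
Proof. by rewrite -{2}[G]scale1r; apply: pc_next_scale. Qed.

Lemma state_mem ls h f : {subset state h <= ls} -> f \in Fs -> f * h`_0 \in ls.
Proof. by move=> sub f_in; apply: sub; rewrite inE; apply/orP; right; apply/mapP; exists f. Qed.

Lemma state_mem1 ls h : {subset state h <= ls} -> h`_1 \in ls.
Proof. by apply; rewrite inE eqxx. Qed.

Lemma pc_next_state_const ls h (c : F) : {subset state h <= ls} ->
  forall t, t \in state (h * (c%:MP)%:P) -> pc_next ls t.
Proof.
move=> sub t; rewrite inE !coefMC => /predU1P[->|/mapP[f f_in ->]].
  by rewrite mulrC mul_mpolyC; apply/pc_next_scale/state_mem1.
rewrite mulrA mulrC mul_mpolyC; exact/pc_next_scale/state_mem.
Qed.

Lemma pc_next_state_add ls h u v :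
  {subset state (h * u) <= ls} -> {subset state (h * v) <= ls} ->
  forall t, t \in state (h * (u + v)) -> pc_next ls t.
Proof.
move=> subu subv t; rewrite inE mulrDr !coefD => /predU1P[->|/mapP[f f_in ->]].
  constructor 2; exists 1, (h * u)`_1, 1, (h * v)`_1; split; try exact: state_mem1.
  by rewrite !scale1r.
constructor 2; exists 1, (f * (h * u)`_0), 1, (f * (h * v)`_0).
by split; [apply: state_mem|apply: state_mem|rewrite !scale1r mulrDr].
Qed.

(** A variable multiplies every line of the state. The placeholder of an axiom [f] makes the
    constant coefficient 0 and the linear one [f * h_0], which is already a line. *)
Lemma pc_next_state_in ls h (i : nat) : {subset state h <= ls} -> (i < n + m)%N ->
  forall t, t \in state (h * dual_env i) -> pc_next ls t.
Proof.
move=> sub lt_i t; rewrite /dual_env; case: ltnP => [lt_in|le_ni].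
  rewrite /var_env insubT /= inE !coefMC => /predU1P[->|/mapP[f f_in ->]].
    by constructor 3; exists (Ordinal lt_in), h`_1; split; [apply: state_mem1|rewrite mulrC].
  constructor 3; exists (Ordinal lt_in), (f * h`_0).
  by split; [apply: state_mem|rewrite mulrA mulrC].
rewrite mulrA inE !coefMX /= coefMC => /predU1P[->|/mapP[f f_in ->]].
  apply: pc_next_mem; rewrite mulrC.
  by apply: state_mem; rewrite // mem_nth // -(ltn_add2l n) subnKC.
by rewrite mulr0 -[0](scale0r h`_1); apply/pc_next_scale/state_mem1.
Qed.

(** * Line-by-line simulation of a weakly skew circuit *)

Section Simulation.

Variables (C : circuit F) (w : nat -> {poly {mpoly F[n]}}).
Hypothesis wfC : wf_circuit (n + m) C.
Hypothesis wsC : weakly_skew C.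
Hypothesis wE : forall p, (p < size C)%N ->
  w p = match gat C p with
        | GIn i => dual_env i
        | GConst c => (c%:MP)%:P
        | GAdd j l => w j + w l
        | GMul j l => w j * w l
        end.

Lemma reach_trans j q r : reach C j q -> reach C q r -> reach C j r.
Proof. by elim=> // j1 r1 q1 r1_in _ IH /IH; apply: reach_step. Qed.

Lemma reach_leq j q : (j < size C)%N -> reach C j q -> (q <= j)%N.
Proof.
move=> lt_j r; elim: r lt_j => // j1 r1 q1 r1_in _ IH lt_j1.
have [_ /(_ _ lt_j1)[/(_ _ r1_in) lt_r1 _]] := wfC.
by apply: leq_trans (IH _) (ltnW lt_r1); apply: ltn_trans lt_r1 lt_j1.
Qed.

Definition separator p j l : Prop :=
  (gat C p = GMul j l \/ gat C p = GMul l j) /\ separated C p j l.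

(** A gate inside the separated factor of a product is simulated on top of the other factor, so its
    own product with the initial state is not promised. *)
Definition reusable (S : pred nat) (g : nat) : Prop :=
  forall p j l, S p -> separator p j l -> ~ reach C j g.

Definition closed_gates (S : pred nat) : Prop :=
  forall p, S p -> (p < size C)%N /\ forall r, r \in grefs (gat C p) -> S r.

Lemma closed_reach S j q : closed_gates S -> S j -> reach C j q -> S q.
Proof. by move=> clS Sj r; elim: r Sj => // j1 r1 q1 r1_in _ IH /clS[_ /(_ _ r1_in)]. Qed.

Lemma grefs_lt p r : (p < size C)%N -> r \in grefs (gat C p) -> (r < p)%N.
Proof. by have [_ H] := wfC => /H[+ _]; apply. Qed.

Lemma separator_lt p j l : (p < size C)%N -> separator p j l -> (j < p)%N /\ (l < p)%N.
Proof.
by move=> lt_p [[E|E] _]; split; apply: grefs_lt => //; rewrite E !inE eqxx ?orbT.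
Qed.

Lemma reusable_max S p : closed_gates S -> (forall q, S q -> (q <= p)%N) -> reusable S p.
Proof.
move=> clS maxp q j l Sq sep r; have [lt_q _] := clS _ Sq.
have [lt_j _] := separator_lt lt_q sep.
have := reach_leq (ltn_trans lt_j lt_q) r; have := maxp _ Sq; lia.
Qed.

(** If the operand [r] lay under the separated factor of some [q] other than [p], separation would
    put [p] under it too, against the maximality of [p]. *)
Lemma reusable_ref S p r (S' : pred nat) :
  closed_gates S -> S p -> (forall q, S q -> (q <= p)%N) -> r \in grefs (gat C p) ->
  (forall q, S' q -> S q /\ q <> p) -> reusable S' r.
Proof.
move=> clS Sp maxp r_in sub q j l /sub[Sq ne_qp] sep.
have [lt_p _] := clS _ Sp; case: (sep) => _ [_ H].
exact: (H p r lt_p (nesym ne_qp) (reusable_max clS maxp Sq sep) r_in).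
Qed.

Definition reachb j : pred nat := fun q => excluded_middle_informative (reach C j q).

Lemma reachbP j q : reflect (reach C j q) (reachb j q).
Proof. by rewrite /reachb; case: excluded_middle_informative => H; constructor. Qed.

Lemma count_split (S T : pred nat) p (s : seq nat) :
  uniq s -> p \in s -> S p -> ~~ T p -> (forall q, T q -> S q) ->
  count S s = (count [pred q | [&& S q, q != p & ~~ T q]] s + count T s).+1.
Proof.
move=> us ps Sp nTp TS; rewrite -addn1 -[X in (_ + X)%N](_ : count_mem p s = _).
  rewrite -!sumn_count !sumnE !big_map -!big_split /=; apply: eq_bigr => q _.
  case: (eqVneq q p) => [->|_]; first by rewrite Sp (negbTE nTp) andbF.
  by case: (boolP (T q)) => [/TS->|_]; case: (S q).
by rewrite count_uniq_mem // ps.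
Qed.

(* A weakly skew product is simulated by running the separated factor from the
   state reached by the other factor; separation ensures that the gates of the
   two runs are disjoint, so every gate is processed once. *)
Lemma pc_simulate (S : pred nat) ls h :
  closed_gates S -> pc_sequence ls -> {subset state h <= ls} ->
  exists ls', [/\ (size ls' <= count S (iota 0 (size C)) * m.+1)%N,
    pc_sequence (ls ++ ls')
    & forall g, S g -> reusable S g -> {subset state (h * w g) <= ls ++ ls'}].
Proof.
have [k] := ubnP (count S (iota 0 (size C))).
elim: k S ls h => // k IH S ls h lt_k clS okls subls.
have [|noS] := boolP (has S (iota 0 (size C))); last first.
  exists [::]; rewrite cats0; split=> // g Sg; case/hasP: noS; exists g => //.
  by rewrite mem_iota; have [-> _] := clS _ Sg.
move=> hasS; have exS : exists p, S p by case/hasP: hasS => p _ Sp; exists p.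
have boundS q : S q -> (q <= size C)%N by move=> /clS[/ltnW].
(* The topmost gate of [S] is an operand of no gate of [S], so removing it leaves a closed set. *)
case: (ex_maxnP exS boundS) => p Sp maxp {hasS exS boundS}.
have [lt_p refs_p] := clS _ Sp; have p_in : p \in iota 0 (size C) by rewrite mem_iota.
(* For a gate other than a product: simulate the rest of [S], then append the [m.+1] lines of the
   state of [p]. *)
have next_p (S' := [pred q | [&& S q, q != p & ~~ pred0 q]]) :
    (forall ls', (forall r, r \in grefs (gat C p) -> {subset state (h * w r) <= ls ++ ls'}) ->
       forall t, t \in state (h * w p) -> pc_next (ls ++ ls') t) ->
    exists ls', [/\ (size ls' <= count S (iota 0 (size C)) * m.+1)%N,
      pc_sequence (ls ++ ls')
      & forall g, S g -> reusable S g -> {subset state (h * w g) <= ls ++ ls'}].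
  move=> next; have cntS : count S (iota 0 (size C)) = (count S' (iota 0 (size C))).+1.
    by rewrite (@count_split S pred0 p) ?iota_uniq // count_pred0 addn0.
  have subS q : S' q -> S q /\ q <> p by case/and3P=> Sq /eqP.
  have [||//|//|ls1 [sz1 ok1 st1]] := IH S' ls h; first by rewrite cntS in lt_k.
    move=> q Sq'; have [Sq ne_qp] := subS _ Sq'; have [lt_q refs_q] := clS _ Sq.
    split=> // r r_in; rewrite /S' /= refs_q //= andbT.
    by rewrite neq_ltn (leq_trans (grefs_lt lt_q r_in) (maxp _ Sq)).
  exists (ls1 ++ state (h * w p)); split.
  - by rewrite size_cat size_state cntS mulSn addnC leq_add2l.
  - rewrite catA; apply: pc_sequence_cat ok1 (next _ _) => r r_in.
    have lt_r := grefs_lt lt_p r_in.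
    apply: st1; first by rewrite /S' /= refs_p //=; lia.
    exact: reusable_ref r_in subS.
  - move=> g Sg reus q; rewrite catA mem_cat; have [->|ne_gp] := eqVneq g p.
      by move->; rewrite orbT.
    move=> q_in; apply/orP; left; apply: st1 q_in; first by rewrite /S' /= Sg ne_gp.
    by move=> q' j l /subS[Sq' _]; apply: reus.
have subW ls' q : q \in ls -> q \in ls ++ ls' by rewrite mem_cat => ->.
have mul_p j l : separator p j l -> w p = w l * w j ->
    exists ls', [/\ (size ls' <= count S (iota 0 (size C)) * m.+1)%N,
      pc_sequence (ls ++ ls')
      & forall g, S g -> reusable S g -> {subset state (h * w g) <= ls ++ ls'}].
  move=> sep Ew; have [lt_j lt_l] := separator_lt lt_p sep.
  have [refj refl] : j \in grefs (gat C p) /\ l \in grefs (gat C p).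
    by case: sep => -[->|->] _; rewrite !inE !eqxx ?orbT.
  have lt_jC := ltn_trans lt_j lt_p.
  have TS q : reachb j q -> S q by move/reachbP; apply: closed_reach => //; apply: refs_p.
  have clT : closed_gates (reachb j).
    move=> q /reachbP rjq; split; first exact: leq_ltn_trans (reach_leq lt_jC rjq) lt_jC.
    move=> r r_in; apply/reachbP; apply: reach_trans rjq _.
    exact: reach_step r_in (reach_refl _ _).
  have nTp : ~~ reachb j p.
    by apply/reachbP => /(reach_leq lt_jC); rewrite leqNgt lt_j.
  have cntS := count_split (iota_uniq 0 (size C)) p_in Sp nTp TS.
  set S' := [pred q | _] in cntS.
  have subS q : S' q -> S q /\ q <> p by case/and3P=> Sq /eqP.
  (* First run, from [h], on [S] without [p] and the gates under [j]; this set is closed because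
     separation forbids references from it to gates under [j]. *)
  have [ls1 [sz1 ok1 st1]] : exists ls', [/\ (size ls' <= count S' (iota 0 (size C)) * m.+1)%N,
      pc_sequence (ls ++ ls')
      & forall g, S' g -> reusable S' g -> {subset state (h * w g) <= ls ++ ls'}].
    apply: IH => //; first by rewrite cntS in lt_k; lia.
    move=> q /and3P[Sq ne_qp nTq]; have [lt_q refs_q] := clS _ Sq; split=> // r r_in.
    rewrite /S' /= refs_q //=; apply/andP; split.
      by rewrite neq_ltn (leq_trans (grefs_lt lt_q r_in) (maxp _ Sq)).
    apply/reachbP; case: sep => _ [_ H]; apply: (H q) => //; first exact/eqP.
    exact/reachbP.
  have Sl' : S' l.
    rewrite /S' /= refs_p //= (ltn_eqF lt_l) /=; apply/reachbP.
    by case: sep => _ [].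
  have stl := st1 _ Sl' (reusable_ref clS Sp maxp refl subS).
  (* Second run, from [h * w l], on the gates under [j]; its state at [j] is the one wanted at [p],
     which needs no lines of its own. *)
  have [ls2 [sz2 ok2 st2]] : exists ls',
      [/\ (size ls' <= count (reachb j) (iota 0 (size C)) * m.+1)%N,
      pc_sequence ((ls ++ ls1) ++ ls')
      & forall g, reachb j g -> reusable (reachb j) g ->
          {subset state (h * w l * w g) <= (ls ++ ls1) ++ ls'}].
    by apply: IH => //; rewrite cntS in lt_k; lia.
  exists (ls1 ++ ls2); rewrite catA; split; [|exact: ok2|].
    rewrite cntS mulSn; apply: leq_trans (leq_addl m.+1 _); rewrite size_cat mulnDl.
    exact: leq_add sz1 sz2.
  move=> g Sg reus; have [->|ne_gp] := eqVneq g p.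
    rewrite Ew mulrA; apply: st2; first by apply/reachbP; apply: reach_refl.
    by apply: reusable_max => // q /reachbP /(reach_leq lt_jC).
  move=> q q_in; rewrite mem_cat; apply/orP; left; apply: (st1 g) q_in.
    by rewrite /S' /= Sg ne_gp; apply/reachbP; apply: reus sep.
  by move=> q' j' l' /subS[Sq' _]; apply: reus.
case Ep: (gat C p) => [i|c|j l|j l].
- apply: next_p => ls' _; rewrite wE // Ep; apply: pc_next_state_in.
    by move=> q /subls; apply: subW.
  by have [_ /(_ _ lt_p)[_]] := wfC; apply.
- apply: next_p => ls' _; rewrite wE // Ep; apply: pc_next_state_const.
  by move=> q /subls; apply: subW.
- apply: next_p => ls' refs; rewrite wE // Ep; apply: pc_next_state_add.
    by apply: refs; rewrite Ep !inE eqxx.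
  by apply: refs; rewrite Ep !inE eqxx orbT.
- have := wE lt_p; rewrite Ep => Ew.
  have [sep|sep] := wsC lt_p Ep.
    by apply: (mul_p j l); [split=> //; left|rewrite mulrC].
  by apply: (mul_p l j); [split=> //; right|].
Qed.

Lemma pc_refutation_of_simulation : (0 < m)%N -> (w (size C).-1)`_1 = 1 ->
  exists D : seq (pc_step F n),
    PC_refutation Fs D /\ (size D <= (size C).+1 * m.+1 + 1)%N.
Proof.
move=> m_gt0 w1; have C_gt0 : (0 < size C)%N by case: wfC => + _; case: (C).
have clC : closed_gates [pred p | (p < size C)%N].
  by move=> p /= lt_p; split=> // r r_in; apply: ltn_trans (grefs_lt lt_p r_in) lt_p.
have ok0 : pc_sequence (Fs ++ [:: 0]).
  rewrite -[Fs]cat0s; apply: pc_sequence_cat.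
    apply: pc_sequence_cat; first by exists [::].
    by move=> t t_in; constructor 1.
  move=> t; rewrite inE => /eqP->; rewrite cat0s -(scale0r Fs`_0).
  by apply: pc_next_scale; apply: mem_nth.
have sub0 : {subset state 1 <= Fs ++ [:: 0]}.
  move=> t; rewrite inE !coef1 /= => /predU1P[->|].
    by rewrite mem_cat inE eqxx orbT.
  by case/mapP=> f f_in ->; rewrite mulr1 mem_cat f_in.
have [ls [sz okls stls]] := pc_simulate clC ok0 sub0.
have one_in : 1 \in (Fs ++ [:: 0]) ++ ls.
  apply: (stls (size C).-1) => /=; first by rewrite prednK.
    by apply: reusable_max => // q lt_q; rewrite -ltnS prednK.
  by rewrite mul1r -w1 inE eqxx.
have [D okD ED] := pc_sequence_rcons okls (pc_next_mem one_in).
have szD := size_pc_lines D; rewrite ED in szD.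
exists D; split.
  split; first by move=> D0; rewrite D0 size_rcons in szD.
  by split=> //; rewrite ED last_rcons.
rewrite -szD size_rcons !size_cat /=.
have : (count [pred p | (p < size C)%N] (iota 0 (size C)) <= size C)%N.
  by rewrite -[X in (_ <= X)%N](size_iota 0) count_size.
rewrite -(leq_pmul2r (ltn0Sn m)) => le_cnt; have := leq_trans sz le_cnt.
by rewrite mulSn; lia.
Qed.

End Simulation.

Lemma x_embed_subst_y (G : {mpoly F[n]}) (ys : 'I_m -> {mpoly F[n]}) :
  x_embed m G \mPo @subst_y F n Fs ys = G.
Proof.
have := @rmorph_mpoly_ext F n _ (comp_mpoly (@subst_y F n Fs ys) \o
  comp_mpoly [tuple 'X_(lshift m a) | a < n]) idfun.
apply=> [c|i] /=; first by rewrite !comp_mpolyC.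
by rewrite comp_mpolyXU -tnth_nth tnth_mktuple comp_mpolyXU -tnth_nth tnth_mktuple split_lshift.
Qed.

(** Sending each placeholder to its axiom times epsilon maps [sum_b y_b G_b] to
    [epsilon * sum_b F_b G_b], so the linear coefficient at the output gate is 1. *)
Lemma weakly_skew_to_PC (C : circuit F) :
  (0 < m)%N -> wf_circuit (n + m) C -> weakly_skew C ->
  @IPS_cert F n Fs (cpoly (n + m) C) -> @hilbert_like F n m (cpoly (n + m) C) ->
  exists D : seq (pc_step F n),
    PC_refutation Fs D /\ (size D <= (size C).+1 * m.+1 + 1)%N.
Proof.
move=> m_gt0 wfC wsC [_ cert1] [G EG].
pose theta : {rmorphism {mpoly F[n + m]} -> {poly {mpoly F[n]}}} :=
  mmap (polyC \o @mpolyC n F) (fun i : 'I_(n + m) => dual_env i).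
have thetaC c : theta c%:MP = (c%:MP)%:P by rewrite /theta /= mmapC.
have thetaX i : theta 'X_i = dual_env i by rewrite /theta /= mmapX mmap1U.
pose vals := eval_vals (@var_env F (n + m)) C.
apply: (@pc_refutation_of_simulation C (fun p => theta (nth 0 vals p))) => //.
  move=> p lt_p; have [_ wfC'] := wfC.
  rewrite nth_eval_vals //; last by move=> q /wfC'[].
  have [_] := wfC' _ lt_p; case: (gat C p) => [i|c|j l|j l] /=.
  - by move/(_ i erefl) => lt_i; rewrite /var_env insubT /= thetaX.
  - by move=> _; apply: thetaC.
  - by move=> _; apply: (rmorphD theta).
  - by move=> _; apply: (rmorphM theta).
have -> : nth 0 vals (size C).-1 = cpoly (n + m) C.
  by rewrite /cpoly /eval_circ -nth_last size_eval_vals.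
have theta_x (H : {mpoly F[n]}) : theta (x_embed m H) = H%:P.
  have := @rmorph_mpoly_ext F n _ (theta \o comp_mpoly [tuple 'X_(lshift m a) | a < n]) polyC.
  apply=> [c|i] /=; first by rewrite comp_mpolyC thetaC.
  rewrite comp_mpolyXU -tnth_nth tnth_mktuple thetaX /dual_env /= ltn_ord.
  by rewrite /var_env valK.
rewrite EG rmorph_sum coef_sum -[RHS]cert1 EG rmorph_sum; apply: eq_bigr => b _ /=.
rewrite !rmorphM theta_x thetaX /dual_env /= ltnNge leq_addr /= addKn.
rewrite coefMC coefMX /= coefC /= x_embed_subst_y.
by rewrite comp_mpolyXU -tnth_nth tnth_mktuple split_rshift.
Qed.

End PolynomialCalculus.

(** * Uniform bounds *)

(** The number of variables, the number of clauses and their widths are at most [s], and bounded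
    sequences over a finite type form a finite type. *)
Lemma cnf_finite (s : nat) :
  exists (T : finType) (g : T -> cnf), forall chi, (cnf_size chi <= s)%N -> exists t, g t = chi.
Proof.
pose T : finType := {v : 'I_s.+1 & s.-bseq (s.-bseq ('I_v * bool))}.
exists T, (fun t : T => CNF [seq bseqval cl | cl <- bseqval (tagged t)]) => -[nv cls].
rewrite /cnf_size /= => le_s; have lt_nv : (nv < s.+1)%N by lia.
pose cls' : seq (s.-bseq ('I_nv * bool)) := [seq insub_bseq s cl | cl <- cls].
exists (Tagged (fun v : 'I_s.+1 => s.-bseq (s.-bseq ('I_v * bool))) (i := Ordinal lt_nv)
  (insub_bseq s cls')) => /=.
have insubK (A : Type) (u : seq A) : (size u <= s)%N -> bseqval (insub_bseq s u) = u.
  by move=> le_u; exact: (@insubdK _ _ _ [bseq] u le_u).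
congr CNF; rewrite insubK; last by rewrite size_map; lia.
rewrite -[RHS]map_id -map_comp; apply/eq_in_map => cl cl_in /=; apply: insubK.
apply: leq_trans le_s; apply: leq_trans (leq_addl _ _).
by rewrite sumnE big_map (big_rem cl) //= leq_addr.
Qed.

(** By monotonicity the sets of sufficient bounds are upward closed in [nat], hence ordered by
    inclusion, and a finite list of formulas contains one with the smallest set. *)
Lemma hardest_cnf (P : cnf -> nat -> Prop) (s : nat) :
  (forall chi b b', (b <= b')%N -> P chi b -> P chi b') ->
  exists psi, [/\ cnf_unsat psi, (cnf_size psi <= s.+1)%N &
    forall chi, cnf_unsat chi -> (cnf_size chi <= s)%N -> forall b, P psi b -> P chi b].
Proof.
move=> mono; have [T [g gP]] := cnf_finite s.
suff [psi [unsat sz H]] : exists psi, [/\ cnf_unsat psi, (cnf_size psi <= s.+1)%N &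
    forall t, t \in enum T -> cnf_unsat (g t) -> (cnf_size (g t) <= s)%N ->
      forall b, P psi b -> P (g t) b].
  exists psi; split=> // chi unsat' sz'; have [t Et] := gP _ sz'; rewrite -Et in unsat' sz' *.
  by apply: H; rewrite ?mem_enum.
elim: (enum T) => [|t l [psi [unsat sz H]]].
  (* A single empty clause has size 1, which is why the size bound is [s.+1]. *)
  exists (@CNF 0 [:: [::]]); split=> // a; exists [::] => //.
have [hard|easy] := classic (forall b, P psi b -> P (g t) b).
  by exists psi; split=> // t'; rewrite inE => /predU1P[->|/H].
have [[unsat_t sz_t]|nope] := classic (cnf_unsat (g t) /\ (cnf_size (g t) <= s)%N); last first.
  exists psi; split=> // t'; rewrite inE => /predU1P[->|/H] // unsat_t sz_t.
  by case: nope.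
exists (g t); split=> //; first exact: leqW.
(* [b0] suffices for [psi] but not for [g t], so every bound sufficient for [g t] exceeds [b0] and
   suffices for [psi]. *)
have [b0 n_b0] := not_all_ex_not _ _ easy.
have [psi_b0 n_tb0] := imply_to_and _ _ n_b0.
move=> t'; rewrite inE => /predU1P[->//|t'_in] unsat' sz' b Ptb.
have [le_b|lt_b] := leqP b b0; first by case: n_tb0; apply: mono Ptb.
by apply: H => //; apply: mono psi_b0; apply: ltnW.
Qed.

(* A family may be indexed sparsely and contain many formulas of a given size;
   since there are finitely many, it can be replaced by the family whose
   [s]-th member is hardest among all formulas of size at most [s]. *)
Lemma uniform_proof_bound (P : cnf -> nat -> Prop) :
  (forall chi b b', (b <= b')%N -> P chi b -> P chi b') ->
  (forall psi : nat -> cnf, (forall s, cnf_unsat (psi s)) -> polyb (fun s => cnf_size (psi s)) ->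
     exists c : nat, forall s, P (psi s) (c * s ^ c + c)%N) ->
  exists c : nat, forall chi, cnf_unsat chi -> P chi (c * cnf_size chi ^ c + c)%N.
Proof.
move=> mono short; have [psi psiP] := functional_choice _ (fun s => hardest_cnf s mono).
have [c cP] : exists c : nat, forall s, P (psi s) (c * s ^ c + c)%N.
  apply: short => [s|]; first by have [] := psiP s.
  apply: polyb_le (polyb_add (polyb_cst 1) polyb_id) => s.
  by have [_ + _] := psiP s; rewrite add1n.
exists c => chi unsat; have [_ _ H] := psiP (cnf_size chi).
exact: H.
Qed.

(** * From equalities of classes to short proofs *)

Lemma VNP_eq_VP_hilbert_IPS (R : comNzRingType) (cf : bool) :
  (forall (k : nat -> nat) (f : forall n, {mpoly R[k n]}), VNPc cf f -> VPc cf f) ->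
  exists c : nat, forall chi, cnf_unsat chi -> exists C : circuit R,
    hilbert_IPS_proof cf (cnf_system R chi) C /\
    (size C <= c * cnf_size chi ^ c + c)%N /\
    (msize (cpoly (cnf_nv chi + size (cnf_system R chi)) C) <= c * cnf_size chi ^ c + c)%N.
Proof.
move=> VNP_VP; apply: (@uniform_proof_bound (fun chi b => exists C : circuit R,
    hilbert_IPS_proof cf (cnf_system R chi) C /\ (size C <= b)%N /\
    (msize (cpoly (cnf_nv chi + size (cnf_system R chi)) C) <= b)%N)).
  move=> chi b b' le_b [C [CP [sz deg]]]; exists C.
  by do !split=> //; [exact: leq_trans le_b|exact: leq_trans le_b].
by move=> psi unsat szP; apply/VPc_hilbert_IPS/VNP_VP/VNPc_ips_poly.
Qed.

Lemma VNP_eq_VPws_PC (F : fieldType) :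
  (forall (k : nat -> nat) (f : forall n, {mpoly F[k n]}), VNPc false f -> VPws f) ->
  exists c : nat, forall chi, cnf_unsat chi -> exists D : seq (pc_step F (cnf_nv chi)),
    PC_refutation (cnf_system F chi) D /\ (size D <= c * cnf_size chi ^ c + c)%N.
Proof.
move=> VNP_VPws; apply: (@uniform_proof_bound (fun chi b =>
    exists D : seq (pc_step F (cnf_nv chi)),
      PC_refutation (cnf_system F chi) D /\ (size D <= b)%N)).
  by move=> chi b b' le_b [D [DP sz]]; exists D; split=> //; apply: leq_trans le_b.
move=> psi unsat szP.
have [_ [_ [C [sizeC CP]]]] := VNP_VPws _ _ (VNPc_ips_poly F false szP).
have [c cP] : polyb (fun s => (size (C s)).+1 * (2 * cnf_size (psi s)).+1 + 1)%N.
  apply: polyb_add (polyb_cst 1); apply: polyb_mul.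
    by apply: polyb_le (polyb_add (polyb_cst 1) sizeC).
  by apply: polyb_le (polyb_add (polyb_cst 1) (polyb_mul (polyb_cst 2) szP)).
exists c => s; have [wsC [wfC EC]] := CP s.
have [D [DP szD]] : exists D, PC_refutation (cnf_system F (psi s)) D /\
    (size D <= (size (C s)).+1 * (size (cnf_system F (psi s))).+1 + 1)%N.
  apply: weakly_skew_to_PC wfC wsC _ _; rewrite ?EC; last exact: hilbert_like_ips_poly.
    (* Any assignment falsifies some clause, so the system is non-empty. *)
    have [cl cl_in _] := unsat s (fun=> true).
    by rewrite size_cnf_system addn_gt0; case: (cnf_clauses _) cl_in.
  by split; [apply: ips_poly_y0|apply: ips_poly_unsat].
exists D; split=> //; apply: leq_trans szD _; apply: leq_trans (cP s).
by rewrite leq_add2r leq_mul2l /= size_cnf_system /cnf_size ltnS; lia.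
Qed.

Theorem theorem3p1 (R : comNzRingType) (F : fieldType) :
  (* (i) Hilbert-like IPS_R lower bound implies VNP_R <> VP_R *)
  (forall phi : nat -> cnf, (forall n, cnf_unsat (phi n)) ->
     hilbert_IPS_superpoly R false phi ->
     ~ (forall (k : nat -> nat) (f : forall n, {mpoly R[k n]}),
          VNPc false f <-> VPc false f)) /\
  (* (i) constant-free version: VNP^0_R <> VP^0_R *)
  (forall phi : nat -> cnf, (forall n, cnf_unsat (phi n)) ->
     hilbert_IPS_superpoly R true phi ->
     ~ (forall (k : nat -> nat) (f : forall n, {mpoly R[k n]}),
          VNPc true f <-> VPc true f)) /\
  (* (ii) PC lower bound (lines) implies VNP <> VP_ws *)
  (forall phi : nat -> cnf, (forall n, cnf_unsat (phi n)) ->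
     PC_superpoly F phi ->
     ~ (forall (k : nat -> nat) (f : forall n, {mpoly F[k n]}),
          VNPc false f <-> VPws f)).
Proof.
split; [|split] => phi unsat lower E; apply: lower.
- have [c cP] := VNP_eq_VP_hilbert_IPS (fun k f => proj1 (E k f)).
  by exists c => n; apply: cP.
- have [c cP] := VNP_eq_VP_hilbert_IPS (fun k f => proj1 (E k f)).
  by exists c => n; apply: cP.
- have [c cP] := VNP_eq_VPws_PC (fun k f => proj1 (E k f)).
  by exists c => n; apply: cP.
Qed.
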